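(* Assume the Continuum Hypothesis. Then the Medvedev lattice contains a chain (a set of Medvedev degrees linearly ordered by $<_M$) of cardinality $2^{2^{\aleph_0}}$.
   Context: A mass problem is a subset of $\omega^\omega$. $\mathcal{A}\leq_M\mathcal{B}$ means there is a partial computable functional $\Psi$ defined on all of $\mathcal{B}$ with $\Psi(\mathcal{B})\subseteq\mathcal{A}$; the Medvedev lattice is the set of $\equiv_M$-equivalence classes of mass problems ordered by the induced order. *)

(* Defs.v *)
From HB Require Import structures.
From Stdlib Require Cantor.
From mathcomp Require Import all_boot all_order.
From mathcomp Require Import generic_quotient boolp classical_sets functions.
From mathcomp Require Import cardinality.

Set Implicit Arguments.
Unset Strict Implicit.
Unset Printing Implicit Defensive.

Local Open Scope classical_set_scope.
Local Open Scope card_scope.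
Local Open Scope quotient_scope.

Notation pair2 x y := (Cantor.to_nat (x, y)).

(* Kleene's schemes for the functions partial recursive in an oracle, in unary
   form: several arguments are coded as one by the Cantor pairing. *)
Inductive code :=
| Zero
| Succ
| Fst
| Snd
| Oracle
| Pair of code & code
| Comp of code & code
| Prec of code & code
| Mu of code.

(* [prec_graph G H a m y]: y is the value at m of the function r defined by
   r(0) = G(a) and r(k+1) = H(a, (k, r(k))). *)
Fixpoint prec_graph (G H : nat -> nat -> Prop) (a m y : nat) : Prop :=
  if m is k.+1 then
    exists2 r, prec_graph G H a k r & H (pair2 a (pair2 k r)) y
  else G a y.

(* [eval f c n y]: the program c with oracle f halts on input n with output y.
   In the Mu case, y is least with c(n, y) = 0, and c must halt on (n, k) for
   every k < y. *)
Fixpoint eval (f : nat -> nat) (c : code) (n y : nat) : Prop :=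
  match c with
  | Zero => y = 0
  | Succ => y = n.+1
  | Fst => y = (Cantor.of_nat n).1
  | Snd => y = (Cantor.of_nat n).2
  | Oracle => y = f n
  | Pair c d =>
      exists u v, [/\ eval f c n u, eval f d n v & y = pair2 u v]
  | Comp c d => exists2 u, eval f d n u & eval f c u y
  | Prec c d =>
      prec_graph (eval f c) (eval f d)
        (Cantor.of_nat n).1 (Cantor.of_nat n).2 y
  | Mu c =>
      eval f c (pair2 n y) 0 /\
      forall k, k < y -> exists r, eval f c (pair2 n k) r.+1
  end.

Lemma eval_functional f c n y z : eval f c n y -> eval f c n z -> y = z.
Proof.
elim: c n y z => [||||| c IHc d IHd | c IHc d IHd | c IHc d IHd | c IHc] n y z
  /=; do ?by move=> -> ->.
- move=> [u [v [cu dv ->]]] [u' [v' [cu' dv' ->]]].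
  by rewrite (IHc _ _ _ cu cu') (IHd _ _ _ dv dv').
- move=> [u du cy] [u' du' cz]; rewrite (IHd _ _ _ du' du) in cz.
  exact: IHc cy cz.
- move: (Cantor.of_nat n).1 (Cantor.of_nat n).2 => a m.
  elim: m y z => [|m IHm] y z /=; first exact: IHc.
  move=> [r mr dy] [r' mr' dz]; rewrite (IHm _ _ mr' mr) in dz.
  exact: IHd dy dz.
- move=> [cy ly] [cz lz]; have [yz|zy|//] := ltngtP y z.
  + by have [r /(IHc _ _ _ cy)] := lz _ yz.
  + by have [r /(IHc _ _ _ cz)] := ly _ zy.
Qed.

Definition baire := nat -> nat.

Definition mass_problem := set baire.

(* A partial functional on Baire space, given by its graph: [Psi f g] says that
   Psi(f) is defined and equal to g. *)
Definition partial_functional := baire -> baire -> Prop.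

(* The domain of Psi consists of the f for which c with oracle f is total. *)
Definition partial_computable (Psi : partial_functional) : Prop :=
  exists c : code,
    forall f g : baire, Psi f g <-> forall n, eval f c n (g n).

Lemma partial_computable_functional Psi f g h :
  partial_computable Psi -> Psi f g -> Psi f h -> g = h.
Proof.
move=> [c cP] /cP fg /cP fh; apply/funext => n.
exact: eval_functional (fg n) (fh n).
Qed.

Definition medvedev_le (A B : mass_problem) : Prop :=
  exists Psi : partial_functional,
    [/\ partial_computable Psi,
        forall f, B f -> exists g, Psi f g
      & forall f g, B f -> Psi f g -> A g].

Definition medvedev_equiv (A B : mass_problem) : Prop :=
  medvedev_le A B /\ medvedev_le B A.

Lemma medvedev_le_refl A : medvedev_le A A.
Proof.
exists (fun f g => f = g); split; last by move=> f g ? <-.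
- exists Oracle => f g /=; split => [-> //|fg].
  by apply/funext => n; rewrite fg.
- by move=> f _; exists f.
Qed.

Fixpoint oracle_subst (c d : code) : code :=
  match c with
  | Oracle => d
  | Pair c1 c2 => Pair (oracle_subst c1 d) (oracle_subst c2 d)
  | Comp c1 c2 => Comp (oracle_subst c1 d) (oracle_subst c2 d)
  | Prec c1 c2 => Prec (oracle_subst c1 d) (oracle_subst c2 d)
  | Mu c1 => Mu (oracle_subst c1 d)
  | c => c
  end.

Lemma eval_oracle_subst (f g : baire) c d :
  (forall n, eval f d n (g n)) -> eval f (oracle_subst c d) = eval g c.
Proof.
move=> dg; elim: c => //= [|c -> c' -> //|c -> c' -> //|c -> c' -> //|c -> //].
apply/funext => n; apply/funext => y; apply/propext.
by split => [dy|->//]; exact: eval_functional dy (dg n).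
Qed.

Lemma medvedev_le_trans B A C :
  medvedev_le A B -> medvedev_le B C -> medvedev_le A C.
Proof.
move=> [P [[c cP] domP PA]] [Q [[d dQ] domQ QB]].
exists (fun f h => forall n, eval f (oracle_subst c d) n (h n)); split.
- by exists (oracle_subst c d).
- move=> f Cf; have [g fg] := domQ f Cf.
  have [h gh] := domP g (QB _ _ Cf fg); exists h.
  by rewrite (eval_oracle_subst c (iffLR (dQ f g) fg)); exact/cP.
- move=> f h Cf; have [g fg] := domQ f Cf.
  rewrite (eval_oracle_subst c (iffLR (dQ f g) fg)) => /cP.
  exact: PA (QB _ _ Cf fg).
Qed.

Definition medvedev_equivb : rel mass_problem :=
  fun A B => `[< medvedev_equiv A B >].

Lemma medvedev_equivb_refl : reflexive medvedev_equivb.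
Proof. by move=> A; apply/asboolP; split; exact: medvedev_le_refl. Qed.

Lemma medvedev_equivb_sym : symmetric medvedev_equivb.
Proof. by move=> A B; apply/asboolP/asboolP => -[]. Qed.

Lemma medvedev_equivb_trans : transitive medvedev_equivb.
Proof.
move=> B A C /asboolP[AB BA] /asboolP[BC CB]; apply/asboolP.
by split; exact: (medvedev_le_trans (B := B)).
Qed.

Canonical medvedev_equiv_rel :=
  EquivRel medvedev_equivb medvedev_equivb_refl medvedev_equivb_sym
    medvedev_equivb_trans.

Definition medvedev_degree : Type := {eq_quot medvedev_equivb}.
HB.instance Definition _ := Choice.on medvedev_degree.

Definition medvedev_deg (A : mass_problem) : medvedev_degree :=
  \pi_{eq_quot medvedev_equivb} A.

Lemma eq_medvedev_deg A B :
  medvedev_deg A = medvedev_deg B <-> medvedev_equiv A B.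
Proof.
split=> [/eqP|AB]; last by apply/eqP; rewrite eqmodE; exact/asboolP.
by rewrite eqmodE => /asboolP.
Qed.

Definition degree_repr (x : medvedev_degree) : mass_problem :=
  repr (x : {eq_quot medvedev_equivb}).

Lemma degree_reprK : cancel degree_repr medvedev_deg.
Proof. by move=> x; exact: reprK. Qed.

Definition degree_le : rel medvedev_degree :=
  fun x y => `[< medvedev_le (degree_repr x) (degree_repr y) >].

Lemma degree_le_refl : reflexive degree_le.
Proof. by move=> x; apply/asboolP; exact: medvedev_le_refl. Qed.

Lemma degree_le_anti : antisymmetric degree_le.
Proof.
move=> x y /andP[/asboolP xy /asboolP yx].
by rewrite -(degree_reprK x) -(degree_reprK y); apply/eq_medvedev_deg.
Qed.

Lemma degree_le_trans : transitive degree_le.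
Proof.
move=> y x z /asboolP xy /asboolP yz; apply/asboolP.
exact: medvedev_le_trans xy yz.
Qed.

Fact medvedev_display : Order.disp_t. Proof. exact: (Order.Disp tt tt). Qed.

HB.instance Definition _ := Order.Le_isPOrder.Build medvedev_display
  medvedev_degree degree_le_refl degree_le_anti degree_le_trans.

(* The order on degrees does not depend on the choice of representatives. *)
Lemma medvedev_deg_le A B :
  (medvedev_deg A <= medvedev_deg B)%O <-> medvedev_le A B.
Proof.
have e C : medvedev_equiv (degree_repr (medvedev_deg C)) C.
  by apply/eq_medvedev_deg; rewrite degree_reprK.
have [[A1 A2] [B1 B2]] := (e A, e B); split => [/asboolP|] AB.
  exact: medvedev_le_trans A2 (medvedev_le_trans AB B1).
by apply/asboolP; exact: medvedev_le_trans A1 (medvedev_le_trans AB B2).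
Qed.

Definition continuum_hypothesis : Prop :=
  forall X : set (set nat), countable X \/ X #= [set: set nat].

(* Main.v *)
Require Import Defs.
From Stdlib Require Cantor.
From mathcomp Require Import all_boot all_order.
From mathcomp Require Import boolp classical_sets functions cardinality.
From mathcomp Require Import wochoice.

(* Diagonalizing along the finite levels of a perfect tree produces continuum
   many reals, none of which computes another one. Hence S |-> (the branches in
   S) reverses and reflects inclusion as a map from sets of indices to mass
   problems, and it is enough to find a chain of 2^(2^aleph_0) sets of indices.
   By CH the continuum R has a well-order with countable initial segments.
   Order the subsets of R lexicographically, and send B to the set of countable
   subsets of R that are lexicographically above B: distinct sets B give
   distinct cuts, and countable subsets of R are coded by reals. *)

Local Open Scope classical_set_scope.
Local Open Scope card_scope.

(** * Oracle programs: finite use and enumeration *)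

Definition agree (N : nat) (f g : baire) : Prop := forall m, m < N -> g m = f m.

Lemma agreeW M N f g : M <= N -> agree N f g -> agree M f g.
Proof. by move=> MN fg m mM; apply: fg; exact: leq_trans mM MN. Qed.

Lemma agree_trans N f g h : agree N f g -> agree N g h -> agree N f h.
Proof. by move=> fg gh m mN; rewrite gh// fg. Qed.

(** A halting computation queries the oracle only finitely often. For [Mu] the bound is a maximum
    over the finitely many values tested. *)
Lemma eval_use f c n y : eval f c n y ->
  exists N, forall g, agree N f g -> eval g c n y.
Proof.
elim: c n y => [||||| c IHc d IHd | c IHc d IHd | c IHc d IHd | c IHc] n y /=;
  do ?by move=> ->; exists 0.
- by move=> ->; exists n.+1 => g ->.
- move=> [u [v [/IHc[N cu] /IHd[M dv] ->]]]; exists (maxn N M) => g fg.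
  exists u, v; split=> //; [apply: cu | apply: dv];
    by apply: agreeW fg; rewrite ?leq_maxl ?leq_maxr.
- move=> [u /IHd[N du] /IHc[M cy]]; exists (maxn N M) => g fg.
  exists u; [apply: du | apply: cy]; apply: agreeW fg;
    by rewrite ?leq_maxl ?leq_maxr.
- move: (Cantor.of_nat n).1 (Cantor.of_nat n).2 => a m.
  elim: m y => [|m IHm] y /=; first exact: IHc.
  move=> [r /IHm[N mr] /IHd[M dy]]; exists (maxn N M) => g fg.
  exists r; [apply: mr | apply: dy]; apply: agreeW fg;
    by rewrite ?leq_maxl ?leq_maxr.
- move=> [/IHc[N cy] ly].
  have [M lM] : exists M, forall g, agree M f g ->
      forall k, k < y -> exists r, eval g c (pair2 n k) r.+1.
    elim: y ly {cy} => [|y IHy] ly; first by exists 0.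
    have [k ky|M lM] := IHy; first by apply: ly; exact: ltnW.
    have [r /IHc[L rL]] := ly y (ltnSn y).
    exists (maxn M L) => g fg k; rewrite ltnS leq_eqVlt => /predU1P[->|ky].
      by exists r; apply: rL; apply: agreeW fg; exact: leq_maxr.
    by apply: lM ky; apply: agreeW fg; exact: leq_maxl.
  exists (maxn N M) => g fg; split.
    by apply: cy; apply: agreeW fg; exact: leq_maxl.
  by apply: lM; apply: agreeW fg; exact: leq_maxr.
Qed.

(** Generic trees carry a numbering [pickle], which is transferred to programs. *)
Fixpoint tree_of_code (c : code) : GenTree.tree nat :=
  match c with
  | Zero => GenTree.Leaf 0
  | Succ => GenTree.Leaf 1
  | Fst => GenTree.Leaf 2
  | Snd => GenTree.Leaf 3
  | Oracle => GenTree.Leaf 4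
  | Pair c d => GenTree.Node 0 [:: tree_of_code c; tree_of_code d]
  | Comp c d => GenTree.Node 1 [:: tree_of_code c; tree_of_code d]
  | Prec c d => GenTree.Node 2 [:: tree_of_code c; tree_of_code d]
  | Mu c => GenTree.Node 3 [:: tree_of_code c]
  end.

Fixpoint code_of_tree (t : GenTree.tree nat) : code :=
  match t with
  | GenTree.Leaf 1 => Succ
  | GenTree.Leaf 2 => Fst
  | GenTree.Leaf 3 => Snd
  | GenTree.Leaf 4 => Oracle
  | GenTree.Node 0 [:: t; u] => Pair (code_of_tree t) (code_of_tree u)
  | GenTree.Node 1 [:: t; u] => Comp (code_of_tree t) (code_of_tree u)
  | GenTree.Node 2 [:: t; u] => Prec (code_of_tree t) (code_of_tree u)
  | GenTree.Node 3 [:: t] => Mu (code_of_tree t)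
  | _ => Zero
  end.

Lemma tree_of_codeK : cancel tree_of_code code_of_tree.
Proof. by elim=> //= [c -> d ->|c -> d ->|c -> d ->|c ->]. Qed.

Definition nth_code (i : nat) : code :=
  oapp code_of_tree Zero (@unpickle (GenTree.tree nat) i).

Lemma nth_code_surj c : exists i, nth_code i = c.
Proof.
exists (pickle (tree_of_code c)).
by rewrite /nth_code pickleK /= tree_of_codeK.
Qed.

(** * Separating finite conditions *)

(* A condition (f, N) stands for the finite string f(0), ..., f(N - 1). *)
Definition condition := (baire * nat)%type.

Definition extends (p : condition) (f : baire) : Prop := agree p.2 p.1 f.

Definition refines (p q : condition) : Prop := p.2 <= q.2 /\ extends p q.1.

Lemma refines_refl p : refines p p.
Proof. by split. Qed.

Lemma refines_extends p q f : refines p q -> extends q f -> extends p f.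
Proof. by move=> [pq pq1] qf; apply: agree_trans pq1 _; exact: agreeW qf. Qed.

Lemma refines_trans q p r : refines p q -> refines q r -> refines p r.
Proof.
move=> pq [qr qr1]; split; first by apply: leq_trans qr; case: pq.
exact: refines_extends pq qr1.
Qed.

(** One direction only: the oracle extends p. The other direction arises from the swapped pair of
    nodes. *)
Definition separated (c : code) (p q : condition) : Prop :=
  forall f g, extends p f -> extends q g -> ~ forall n, eval f c n (g n).

Lemma separatedW c p q p' q' : refines p p' -> refines q q' ->
  separated c p q -> separated c p' q'.
Proof.
move=> pp' qq' pq f g p'f q'g.
by apply: pq; [exact: refines_extends p'f | exact: refines_extends q'g].
Qed.

(* Diagonalize at the first position M not decided by q: either some extension
   of p makes c converge at M, and then q can be extended by another value, or
   no extension of p does. *)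
Lemma separate c p q : exists p' q',
  [/\ refines p p', refines q q' & separated c p' q'].
Proof.
case: p q => f N [g M].
have [[f' [v [ff' cv]]]|nc] :=
    pselect (exists f' v, agree N f f' /\ eval f' c M v).
  have [L useL] := eval_use _ _ _ _ cv.
  exists (f', maxn N L), (fun m => if m == M then v.+1 else g m, M.+1); split.
  - by split=> //=; exact: leq_maxl.
  - by split=> //= m /= mM; rewrite ltn_eqF.
  - move=> h k f'h gk hk; have := hk M.
    rewrite gk//= eqxx => /eval_functional/(_ (useL h _)) vv.
    suff /vv/eqP : agree L f' h by rewrite eqn_leq ltnn.
    by apply: agreeW f'h; exact: leq_maxr.
exists (f, N), (g, M); split; [exact: refines_refl | exact: refines_refl |].
by move=> h k fh _ hk; apply: nc; exists h, (k M).
Qed.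

(** * The perfect tree and its branches *)

Definition requirement := (seq bool * seq bool * nat)%type.

Definition meets (s : seq bool -> condition) (r : requirement) : Prop :=
  r.1.1 <> r.1.2 -> separated (nth_code r.2) (s r.1.1) (s r.1.2).

(** Finitely many requirements are treated one at a time, since later refinements preserve
    separation. The length bound n makes the branches total. *)
Lemma refine_meets (rs : seq requirement) (n : nat) (s : seq bool -> condition) :
  exists s', [/\ forall w, refines (s w) (s' w), forall w, n <= (s' w).2
               & forall r, r \in rs -> meets s' r].
Proof.
elim: rs => [|[[u v] i] rs [s' [ss' ns' rss']]].
  exists (fun w => ((s w).1, maxn (s w).2 n)); split=> // w.
    by split=> //=; exact: leq_maxl.
  exact: leq_maxr.
have [uv|/eqP uv] := eqVneq u v.
  exists s'; split=> // r; rewrite inE => /predU1P[->|]; last exact: rss'.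
  by move=> /(_ uv).
have [p [q [up vq pq]]] := separate (nth_code i) (s' u) (s' v).
pose t w := if w == u then p else if w == v then q else s' w.
have s't w : refines (s' w) (t w).
  rewrite /t; case: eqP => [->//|_]; case: eqP => [->//|_].
  exact: refines_refl.
exists t; split.
- by move=> w; exact: refines_trans (s't w).
- by move=> w; apply: leq_trans (ns' w) _; case: (s't w).
- move=> r; rewrite inE => /predU1P[-> _|/rss' r_met r12] /=.
    by rewrite /t eqxx eqxx; case: eqP => // vu; case: uv.
  exact: separatedW (s't _) (s't _) (r_met r12).
Qed.

Definition level (n : nat) : seq (seq bool) :=
  [seq val u | u <- enum {: n.-tuple bool}].

Definition requirements (n : nat) : seq requirement :=
  [seq (w, i) | w <- [seq (u, v) | u <- level n, v <- level n], i <- iota 0 n].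

Lemma mem_level (x : nat -> bool) n : mkseq x n \in level n.
Proof.
apply/mapP; exists (Tuple (introT eqP (size_mkseq x n))) => //.
by rewrite mem_enum.
Qed.

Lemma mem_requirements x y n i : i < n ->
  (mkseq x n, mkseq y n, i) \in requirements n.
Proof.
move=> i_n; apply/allpairsP; exists ((mkseq x n, mkseq y n), i); split=> //=.
  by apply/allpairsP; exists (mkseq x n, mkseq y n); rewrite !mem_level.
by rewrite mem_iota.
Qed.

(** Node w of level m.+1 refines its parent [take m w]; at level n only lists of length n matter.
    Level 0 may be trivial, as [requirements 0] is empty. *)
Fixpoint perfect_tree (n : nat) : seq bool -> condition :=
  if n is m.+1 then
    sval (cid (refine_meets (requirements n) n
                 (fun w => perfect_tree m (take m w))))
  else fun=> (fun=> 0, 0).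

Lemma perfect_tree_refines n w :
  refines (perfect_tree n (take n w)) (perfect_tree n.+1 w).
Proof. by rewrite /=; case: cid => s [] /=. Qed.

Lemma perfect_tree_size n w : n <= (perfect_tree n w).2.
Proof. by case: n => // n; rewrite /=; case: cid => s [] /=. Qed.

Lemma perfect_tree_meets n r : r \in requirements n -> meets (perfect_tree n) r.
Proof.
case: n => [|n]; last by rewrite /=; case: cid => s [_ _ sP] /= /sP.
by move=> /allpairsP[[w i] [_ /=]]; rewrite in_nil.
Qed.

Definition branch (x : nat -> bool) (n : nat) : condition :=
  perfect_tree n (mkseq x n).

Lemma branch_refines x m n : m <= n -> refines (branch x m) (branch x n).
Proof.
move=> /subnK <-; elim: (n - m) => [|k IH]; first exact: refines_refl.
apply: refines_trans IH _; rewrite addSn /branch.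
have := perfect_tree_refines (k + m) (mkseq x (k + m).+1).
by rewrite /mkseq -map_take take_iota (minn_idPl (leqnSn _)).
Qed.

(** Level m.+1 is used because its conditions have length at least m.+1, so position m is decided
    there. *)
Definition branch_fun (x : nat -> bool) : baire :=
  fun m => (branch x m.+1).1 m.

Lemma extends_branch_fun x n : extends (branch x n) (branch_fun x).
Proof.
move=> m mn; rewrite /branch_fun; have [nm|mn'] := leqP n m.+1.
  by case: (branch_refines x _ _ nm) => _; apply.
case: (branch_refines x _ _ (ltnW mn')) => _ -> //.
exact: perfect_tree_size.
Qed.

Lemma branch_fun_incomparable x y c :
  (forall n, eval (branch_fun x) c n (branch_fun y n)) -> x = y.
Proof.
have [i <-] := nth_code_surj c => xy; apply/funext => k; apply: contrapT => xyk.
(* At this level the prefixes of x and y already differ and program i is among those diagonalized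
   against. *)
pose n := (maxn i k).+1.
have kn : k < n by rewrite ltnS leq_maxr.
have i_n : i < n by rewrite ltnS leq_maxl.
apply: perfect_tree_meets (mem_requirements x y n i i_n) _ _ _ _ _ xy => /=.
- move=> /(congr1 (fun s => nth false s k)).
  by rewrite !nth_mkseq.
- exact: extends_branch_fun.
- exact: extends_branch_fun.
Qed.

Definition branch_problem (S : set (nat -> bool)) : mass_problem :=
  branch_fun @` S.

(** A reduction sends each branch to a branch that it computes, which can only be itself.
    Conversely, the identity reduces a subset to a superset. *)
Lemma branch_problem_le S S' :
  medvedev_le (branch_problem S) (branch_problem S') <-> S' `<=` S.
Proof.
split=> [[Psi [[c cP] dom sub]] x S'x|S'S].
  have S'fx : branch_problem S' (branch_fun x) by exists x.
  have [g xg] := dom _ S'fx; have [y Sy yg] := sub _ _ S'fx xg.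
  suff -> : x = y by [].
  by apply: (branch_fun_incomparable x y c); rewrite yg; exact/cP.
exists (fun f g => f = g); split.
- exists Oracle => f g /=; split=> [-> //|fg].
  by apply/funext => n; rewrite fg.
- by move=> f _; exists f.
- by move=> _ _ [x S'x <-] <-; exists x => //; exact: S'S.
Qed.

(** * Well-orders, and a short one of the continuum under CH *)

Lemma well_order_min (T : eqType) (R : rel T) (A : set T) : well_order R ->
  A !=set0 -> exists2 m, A m & forall x, A x -> R m x.
Proof.
move=> woR [a Aa]; have [|m [[mA mP] _]] := woR (mem A).
  by exists a; exact: mem_set.
exists m; first exact: set_mem mA.
by move=> x Ax; apply: mP; exact: mem_set.
Qed.

Lemma well_order_total (T : eqType) (R : rel T) : well_order R -> total R.
Proof.
move=> woR x y; have [|m [->|->] mP] := well_order_min _ _ [set x; y] woR.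
- by exists x; left.
- by rewrite mP//; right.
- by rewrite (mP x) ?orbT//; left.
Qed.

Lemma well_order_refl (T : eqType) (R : rel T) : well_order R -> reflexive R.
Proof. by move=> /well_order_total tR x; have := tR x x; rewrite orbb. Qed.

(** Both x and y are minima of {x, y}, and [well_order] makes minima unique. *)
Lemma well_order_anti (T : eqType) (R : rel T) : well_order R -> antisymmetric R.
Proof.
move=> woR x y /andP[xy yx].
have [|m [_ mP]] := woR (mem [set x; y]); first by exists x; rewrite inE; left.
by rewrite -(mP x) ?(mP y)//; split; rewrite ?inE; do ?[by left|by right];
  move=> z; rewrite inE => -[->|->] //; exact: well_order_refl.
Qed.

Lemma well_order_trans (T : eqType) (R : rel T) : well_order R -> transitive R.
Proof.
move=> woR y x z xy yz.
have [|m mA mP] := well_order_min _ _ [set x; y; z] woR.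
  by exists x; left; left.
case: mA mP => [[->|->]|->] mP; first by apply: mP; right.
  suff -> : x = y by [].
  by apply: (well_order_anti _ _ woR); rewrite xy mP//; left; left.
suff <- : y = z by [].
by apply: (well_order_anti _ _ woR); rewrite yz mP//; left; right.
Qed.

Lemma well_order_preimage (T U : eqType) (R : rel U) (h : T -> U) :
  injective h -> well_order R -> well_order (relpre h R).
Proof.
move=> inj_h woR; apply: antisymmetric_well_order => [x y /= xy|A [a Aa]].
  by apply: inj_h; exact: (well_order_anti _ _ woR).
have [|_ [m mA <-] mP] := well_order_min _ _ (h @` [set` A]) woR.
  by exists (h a), a.
by exists m; split=> // x xA /=; apply: mP; exists x.
Qed.

(* If some initial segment is uncountable, the least such one has the size of
   the continuum by CH and carries the required order. *)
Lemma CH_well_order : continuum_hypothesis ->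
  exists2 R : rel (set nat), well_order R &
    forall a, countable [set b | R b a].
Proof.
move=> CH; have [R woR] := well_ordering_principle (set nat).
pose seg a := [set b | R b a].
have [allc|nc] := pselect (forall a, countable (seg a)); first by exists R.
have [|a /= nca amin] :=
    well_order_min _ _ [set a | ~ countable (seg a)] woR.
  by apply: contrapT => nex; apply: nc => a; apply: contrapT => ca; apply: nex;
    exists a.
(* Without [a] the segment is still uncountable, and each remaining point has a countable segment by
   minimality of [a]. The numbering is shifted to free 0 for [a]. *)
have ncD : ~ countable (seg a `\ a).
  move=> /countable_injP[f f_inj]; apply: nca; apply/countable_injP.
  exists (fun b => if b == a then 0 else (f b).+1) => b c; rewrite !inE.
  case: eqP => [->|ba]; case: eqP => [->|ca] // Rba Rca [fbc].
  by apply: f_inj => //; rewrite inE.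
have [//|] := CH (seg a `\ a).
move=> /card_esym/card_set_bijP[h [hseg inj_h _]].
have h_inj : injective h by move=> x y; apply: inj_h; rewrite inE.
exists (relpre h R); first exact: well_order_preimage.
move=> x; have [Rhxa hxa] := hseg x I.
have chx : countable (seg (h x)).
  apply: contrapT => /amin Rahx; apply: hxa.
  by apply: (well_order_anti _ _ woR); apply/andP.
apply: sub_countable chx.
rewrite -(card_le_eql (inj_card_eq (f := h) _)); last by move=> ? ? _ _ /h_inj.
by apply: subset_card_le => _ [y /= yx <-].
Qed.

(** * The lexicographic order on subsets *)

(** For a well-order, [~~ R b c] says that c is strictly before b: thus b is the first difference,
    and the set containing it is the larger. *)
Definition lexlt (T : Type) (R : rel T) (A B : set T) : Prop :=
  exists b, [/\ ~ A b, B b & forall c, ~~ R b c -> (A c <-> B c)].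

Lemma lexlt_total (T : eqType) (R : rel T) (A B : set T) : well_order R ->
  A <> B -> lexlt T R A B \/ lexlt T R B A.
Proof.
move=> woR AB.
have [|b bAB bP] := well_order_min _ _ [set b | ~ (A b <-> B b)] woR.
  apply: contrapT => nex; apply: AB; apply/seteqP.
  by split=> b Xb; apply: contrapT => nb; apply: nex; exists b => -[ab ba];
    apply: nb; [exact: ab | exact: ba].
have agr c : ~~ R b c -> A c <-> B c.
  by move=> nbc; apply: contrapT => /bP; exact/negP.
have [Ab|nAb] := pselect (A b).
  right; exists b; split=> // [Bb|c /agr [? ?]//].
  by apply: bAB; split.
left; exists b; split=> //.
by apply: contrapT => nBb; apply: bAB; split.
Qed.

(** The first difference of A and C is the earlier of b and d, which are distinct because only b
    lies in B. *)
Lemma lexlt_trans (T : eqType) (R : rel T) (A B C : set T) : well_order R ->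
  lexlt T R A B -> lexlt T R B C -> lexlt T R A C.
Proof.
move=> woR [b [nAb Bb AB]] [d [nBd Cd BC]].
have bd : b <> d by move=> bd; apply: nBd; rewrite -bd.
have tr := well_order_trans _ _ woR.
have [Rbd|Rdb] := orP (well_order_total _ _ woR b d).
  exists b; split=> //.
    apply/BC => //; apply: contra_notN bd => Rdb.
    by apply: (well_order_anti _ _ woR); rewrite Rbd.
  move=> c nbc; rewrite AB// BC//; apply: contra nbc; exact: tr.
exists d; split=> //.
  rewrite AB//; apply: contra_notN bd => Rbd.
  by apply: (well_order_anti _ _ woR); rewrite Rbd.
move=> c ndc; rewrite AB ?BC//; apply: contra ndc; exact: tr.
Qed.

(** * Coding countable sets by reals; lexicographic cuts *)

Definition columns (x : nat -> bool) : set (set nat) :=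
  range (fun i => [set j | x (pair2 i j)]).

(** An enumeration of S supplies the columns; S must be nonempty since every real has a column. *)
Lemma countable_columns (S : set (set nat)) : countable S -> S !=set0 ->
  exists x, columns x = S.
Proof.
move=> /pfcard_geP[->|/surjfunPex[f fS]] S0; first by case: S0.
exists (fun k => `[< f (Cantor.of_nat k).1 (Cantor.of_nat k).2 >]).
rewrite fS; congr image; apply/funext => i; apply/funext => j.
by rewrite /mkset Cantor.cancel_of_to asboolE.
Qed.

Definition lex_cut (R : rel (set nat)) (B : set (set nat)) : set (nat -> bool) :=
  [set x | lexlt _ R B (columns x)].

Lemma lex_cut_sub (R : rel (set nat)) A B : well_order R ->
  lexlt _ R A B -> lex_cut R B `<=` lex_cut R A.
Proof. by move=> woR AB x; exact: lexlt_trans. Qed.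

(* If b is the least point of difference of A < B, then the bounded part of B
   up to b is a countable set that lies above A but not above B. *)
Lemma lex_cut_nsub (R : rel (set nat)) A B : well_order R ->
  (forall a, countable [set b | R b a]) ->
  lexlt _ R A B -> ~ lex_cut R A `<=` lex_cut R B.
Proof.
move=> woR cR [b [nAb Bb AB]].
have [||x xE] := countable_columns (B `&` [set a | R a b]).
- by apply: sub_countable (cR b); apply: subset_card_le => a [].
- by exists b; split=> //; exact: well_order_refl.
move=> /(_ x) []; rewrite /lex_cut /= xE.
  exists b; split=> //; first by split=> //; exact: well_order_refl.
  move=> c nbc; rewrite AB//; split=> [Bc|[]//]; split=> //=.
  by have := well_order_total _ _ woR b c; rewrite (negbTE nbc).
(* A subset of B is never above B, which would require a point outside B. *)
by move=> d [nBd []].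
Qed.

Theorem theorem4p2 :
  continuum_hypothesis ->
  exists C : set medvedev_degree,
    total_on C (fun x y => (x <= y)%O) /\ C #= [set: set (set nat)].
Proof.
move=> /CH_well_order[R woR cR].
(* Cuts and branch problems both reverse the order, so [D] is increasing. *)
pose D B := medvedev_deg (branch_problem (lex_cut R B)).
have DleP A B : (D A <= D B)%O <-> lex_cut R B `<=` lex_cut R A.
  by rewrite medvedev_deg_le branch_problem_le.
have DN A B : lexlt _ R A B -> D A <> D B.
  move=> AB DAB; apply: lex_cut_nsub AB _ => //.
  by apply/DleP; rewrite DAB.
exists (range D); split.
  move=> _ _ [A _ <-] [B _ <-].
  have [->|/eqP AB] := eqVneq A B; first by left.
  by case: (lexlt_total _ R _ _ woR AB) => /(lex_cut_sub _ _ _ woR)/DleP;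
    [left | right].
apply: inj_card_eq => A B _ _ DAB; apply: contrapT => AB.
by case: (lexlt_total _ R _ _ woR AB) => /DN; apply.
Qed.
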